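(* For every fixed integer $r\ge 2$, we have $f(k,r,s)=\Theta_r\left(\sqrt[r-1]{k^r/s}\right)$ for all $(r-1)!\le s\le k$. That is, for every integer $r\ge2$ there exist constants $c_r,C_r>0$, depending only on $r$, such that for all positive integers $k,s$ with $(r-1)!\le s\le k$, $$c_r\left(\frac{k^r}{s}\right)^{1/(r-1)}\le f(k,r,s)\le C_r\left(\frac{k^r}{s}\right)^{1/(r-1)}.$$
   Context: An $r$-graph is an $r$-uniform hypergraph. For positive integers $n,k,r,s$ with $r\ge2$ and $s\le k$, an $(n,k,r,s)$-graph is an $r$-graph whose vertex set is partitioned into $n$ disjoint parts of size $k$, such that any $r$ distinct parts induce exactly $s$ edges, each containing exactly one vertex from each of these $r$ parts, and such that these $s$ edges form a matching (are pairwise disjoint). An independent transversal of such a hypergraph is a set containing exactly one vertex from each part and not containing any edge. $f(k,r,s)$ denotes the maximum integer $n$ such that every $(n,k,r,s)$-graph has an independent transversal. *)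

(* Defs.v *)
From HB Require Import structures.
From mathcomp Require Import all_boot all_order all_algebra.
From mathcomp Require Import all_classical all_reals all_analysis.

Set Implicit Arguments.
Unset Strict Implicit.
Unset Printing Implicit Defensive.

Local Open Scope nat_scope.

(* [cover], [partition] and [trivIset] are qualified because classical_sets
   shadows the finset versions. *)
Section Hypergraphs.
Variable V : finType.
Implicit Types (P Q E : {set {set V}}) (T : {set V}).

Definition uniform_hypergraph (r : nat) E : Prop :=
  forall e, e \in E -> #|e| = r.

Definition induced_edges E Q : {set {set V}} :=
  [set e in E | e \subset finset.cover Q].

Definition nkrs_graph (n k r s : nat) P E : Prop :=
  [/\ uniform_hypergraph r E,
      finset.partition P [set: V],
      #|P| = n,
      (forall B, B \in P -> #|B| = k) &
      forall Q, Q \subset P -> #|Q| = r ->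
        [/\ #|induced_edges E Q| = s,
            forall e B, e \in induced_edges E Q -> B \in Q -> #|e :&: B| = 1 &
            finset.trivIset (induced_edges E Q)]].

Definition independent_transversal P E T : Prop :=
  is_transversal T P [set: V] /\ forall e, e \in E -> ~~ (e \subset T).

End Hypergraphs.

Definition always_independent_transversal (k r s n : nat) : Prop :=
  forall (V : finType) (P E : {set {set V}}),
    nkrs_graph n k r s P E -> exists T, independent_transversal P E T.

Definition is_max_order (k r s n : nat) : Prop :=
  always_independent_transversal k r s n /\
  forall m, always_independent_transversal k r s m -> m <= n.

(* The default value 0 is taken only when no maximum exists, so positive values
   are genuine maxima; see [f_max]. *)
Definition f (k r s : nat) : nat :=
  xget 0 [set n | is_max_order k r s n]%classic.

Lemma f_max (k r s : nat) : 0 < f k r s -> is_max_order k r s (f k r s).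
Proof. by rewrite /f; case: xgetP => [n _ //|_]; rewrite ltnn. Qed.

Lemma f_unique (k r s n : nat) : is_max_order k r s n -> f k r s = n.
Proof.
move=> [hn maxn]; rewrite /f; case: xgetP => [m _ [hm maxm]|none].
  by apply/eqP; rewrite eqn_leq maxn // maxm.
by case: (none n).
Qed.

(* Main.v *)
Require Import Defs.
From mathcomp Require Import all_classical all_reals all_analysis.
From mathcomp Require Import all_boot all_order all_algebra all_solvable all_field.
From mathcomp Require Import zify ring.

Set Implicit Arguments.
Unset Strict Implicit.
Unset Printing Implicit Defensive.

Import Order.TTheory GRing.Theory Num.Theory.
Local Open Scope nat_scope.

(** Write t = r - 1. The two bounds say that the largest n that forces an
independent transversal has n ^ t * s of order k ^ r.

Lower bound. When n ^ t * s * 2 ^ r <= k ^ r, adding one more part to a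
collection of parts multiplies the number of independent partial transversals
by at least k / 2. This is proved by induction together with its own use: an
extension of a partial transversal by a vertex is lost only if it creates an
edge inside r parts; such an edge fixes the new vertex and the partial
transversal on the t old parts among them, so by induction it spoils at most a
fraction (2 / k) ^ t of the partial transversals, and there are few edges. A
growing count stays positive, so an independent transversal exists
([partial_transversals_growth], [sparse_independent_transversal]).

Upper bound. Take words of length k over an alphabet C such that any r distinct
words agree in at most s positions. Let the i-th part consist of the positions
of the i-th word, and put an edge across r parts at each position where their
words agree, completing to s positions. If there are more than t * k * #|C|
words, a transversal chooses r times the same pair (position, letter), which is
an edge ([words_no_transversal]). What is needed is thus about k * #|C| words
with small r-wise agreement, where #|C| is of order (k / s) ^ (1 / t).

Such words come from projective norm graphs. Over a field with q ^ t elements,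
with q of order k ^ (1 / t), let N be the norm to the field with q elements. The
word of (A, c) has at position B the value of N (A + B) / c. Fixing the values of
all quotients N (A_i + B) / N (A_0 + B), for t further words, leaves at most t!
positions: after the substitution Y = 1 / (A_0 + B) this is a system
prod_j (x_j - a_ij) = b_i in the t conjugates x_j of Y, and such a system has
at most t! solutions ([card_product_system_le]). To reach s larger than t!, the
alphabet, which is cyclic of order q - 1, is cut into intervals of a consecutive
powers of a generator; r letters in a common interval have at most 2a - 1
possible ratios to the first, so agreement grows to at most t! * (2a - 1) ^ t,
while the alphabet shrinks by the factor a ([norm_words]). Intervals are used
instead of cosets of a subgroup so that a need not divide q - 1, hence q may be
a power of two and a may be any size. *)

(** * Counting independent partial transversals *)

Lemma leq_card_bigcup (I T : finType) (D : {pred I}) (F : I -> {set T}) :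
  #|\bigcup_(i in D) F i| <= \sum_(i in D) #|F i|.
Proof.
elim/big_rec2: _ => [|i n A _ An]; first by rewrite cards0.
by rewrite (leq_trans (leq_card_setU _ _)) // leq_add2l.
Qed.

Section Counting.
Variables (V : finType) (P E : {set {set V}}) (n k r s : nat).
Hypotheses (H : nkrs_graph n k r s P E) (r_gt1 : 1 < r) (k_gt0 : 0 < k).
Hypothesis sparse : 'C(n.-1, r.-1) * s * 2 ^ r <= k ^ r.
Implicit Types (S Q : {set {set V}}) (B T e : {set V}).

Definition partial_transversals S : {set {set V}} :=
  [set T : {set V} | [&& T \subset cover S, [forall B in S, #|T :&: B| == 1] &
               [forall e in E, ~~ (e \subset T)]]].

Let edge_card e : e \in E -> #|e| = r. Proof. by case: H => + _ _ _ _; apply. Qed.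
Let partP : partition P [set: V]. Proof. by case: H. Qed.
Let cardP : #|P| = n. Proof. by case: H. Qed.
Let card_part B : B \in P -> #|B| = k. Proof. by case: H => _ _ _ + _; apply. Qed.

Let block_eq B B' x : B \in P -> B' \in P -> x \in B -> x \in B' -> B = B'.
Proof.
case/and3P: partP => _ trivP _ BP B'P xB xB'.
by rewrite -(def_pblock trivP BP xB) (def_pblock trivP B'P xB').
Qed.

Lemma partial_transversal_restrict S S' T : S' \subset S -> S \subset P ->
  T \in partial_transversals S -> T :&: cover S' \in partial_transversals S'.
Proof.
move=> sS SP; rewrite !inE => /and3P[_ /forall_inP T1 /forall_inP indep]; apply/and3P; split.
- exact: subsetIr.
- apply/forall_inP => B BS'; rewrite -(eqP (T1 B (subsetP sS B BS'))); apply/eqP.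
  apply: eq_card => x; rewrite !inE -andbA; congr (_ && _); rewrite andbC.
  by case xB: (x \in B) => //=; apply/bigcupP; exists B.
- apply/forall_inP => e /indep; apply: contra => eT.
  by rewrite (subset_trans eT) // subsetIl.
Qed.

(** A conflicting pair (T, v) is determined by what T does outside Q: the edge e
meets each part of [B |: Q] exactly once, so e dictates v and the vertices of T
in the parts of Q. *)
Lemma card_conflict S Q B e : S \subset P -> Q \subset S -> B \in P -> B \notin S ->
  #|B |: Q| = r -> e \in induced_edges E (B |: Q) ->
  #|[set p in setX (partial_transversals S) B | e \subset p.2 |: p.1]|
     <= #|partial_transversals (S :\: Q)|.
Proof.
move=> SP QS BP BS cardBQ e_ind.
have QP := subset_trans QS SP.
have BQP : B |: Q \subset P by rewrite subUset sub1set BP.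
have [_ _ _ _ /(_ _ BQP cardBQ)[_ meet _]] := H.
have eQ : e \subset cover (B |: Q) by move: e_ind; rewrite inE => /andP[].
pose f (p : {set V} * V) := p.1 :&: cover (S :\: Q).
rewrite -(@card_in_imset _ _ f).
  apply/subset_leq_card/subsetP => A /imsetP[[T v]]; rewrite inE /= => /andP[/setXP[/= TS _] _] ->.
  by apply: partial_transversal_restrict TS; rewrite ?subsetDl.
have /eqP/cards1P[u eBu] := meet e B e_ind (setU11 _ _).
have recover T v : T \in partial_transversals S -> v \in B -> e \subset v |: T ->
    v = u /\ T = T :&: cover (S :\: Q) :|: e :&: cover Q.
  rewrite inE => /and3P[TS /forall_inP T1 _] vB evT.
  have TB x : x \in T -> x \notin B.
    move=> /(subsetP TS)/bigcupP[B' B'S xB']; apply/negP => xB.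
    by case/negP: BS; rewrite (block_eq BP (subsetP SP _ B'S) xB xB').
  split.
    have /setIP[ue uB] : u \in e :&: B by rewrite eBu set11.
    by have /setU1P[->//|/TB] := subsetP evT u ue; rewrite uB.
  apply/setP => x; rewrite !inE; apply/idP/orP => [xT|[/andP[//]|/andP[xe /bigcupP[B' B'Q xB']]]].
    have /bigcupP[B' B'S xB'] := subsetP TS x xT.
    case B'Q: (B' \in Q); last by left; rewrite xT; apply/bigcupP; exists B'; rewrite // inE B'Q.
    right; apply/andP; split; last by apply/bigcupP; exists B'.
    have /eqP/cards1P[y ey] := meet e B' e_ind (setU1r _ B'Q).
    have /setIP[ye yB'] : y \in e :&: B' by rewrite ey set11.
    have /cards1P[z Tz] := T1 B' B'S.
    have yT : y \in T.
      have /setU1P[yv|//] := subsetP evT y ye; case/negP: BS.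
      by rewrite (@block_eq B B' v) // ?(subsetP SP) // -yv.
    suff -> : x = y by [].
    have : x \in T :&: B' by rewrite inE xT.
    have : y \in T :&: B' by rewrite inE yT.
    by rewrite Tz !inE => /eqP-> /eqP->.
  have /setU1P[xv|//] := subsetP evT x xe; case/negP: BS.
  by rewrite (@block_eq B B' v) // ?(subsetP QP) // ?(subsetP QS) // -xv.
move=> [T v] [T' v']; rewrite !inE /= => /andP[/andP[TS vB] ev] /andP[/andP[TS' vB'] ev'].
rewrite /f /= => TT'; have [|-> TE] := recover T v _ vB ev; first by rewrite inE.
have [|-> TE'] := recover T' v' _ vB' ev'; first by rewrite inE.
by rewrite TE TE' TT'.
Qed.

(** An (n,k,r,s)-graph constrains only the edges covered by r parts. An edge inside
a partial transversal extended by v is of this kind, because its r vertices lie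
in r distinct parts. *)
Lemma conflict_edge S B T v e : S \subset P -> B \in P -> B \notin S ->
  T \in partial_transversals S -> v \in B -> e \in E -> e \subset v |: T ->
  exists Q, [/\ Q \subset S, #|Q| = r.-1, #|B |: Q| = r & e \in induced_edges E (B |: Q)].
Proof.
move=> SP BP BS; rewrite inE => /and3P[TS /forall_inP T1 /forall_inP indep] vB eE evT.
have ve : v \in e.
  apply: contraR (indep e eE) => ve; apply/subsetP => x xe.
  by have /setU1P[xv|//] := subsetP evT x xe; rewrite xv (negPf ve) in xe.
have eT x : x \in e :\ v -> x \in T.
  by move=> /setD1P[xv /(subsetP evT)/setU1P[xv'|//]]; rewrite xv' eqxx in xv.
have blockS x : x \in T -> pblock P x \in S /\ x \in pblock P x.
  move=> /(subsetP TS)/bigcupP[B' B'S xB'].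
  case/and3P: partP => _ trivP _.
  by rewrite (def_pblock trivP (subsetP SP _ B'S) xB').
pose Q := pblock P @: (e :\ v).
have QS : Q \subset S by apply/subsetP => _ /imsetP[x /eT/blockS[xS _] ->].
have cardQ : #|Q| = r.-1.
  rewrite card_in_imset; first by rewrite -(edge_card eE) (cardsD1 v e) ve.
  move=> x y /eT xT /eT yT xy.
  have [xS xx] := blockS x xT; have [_ yy] := blockS y yT.
  have /cards1P[z Tz] := T1 _ xS.
  have : x \in T :&: pblock P x by rewrite inE xT.
  have : y \in T :&: pblock P x by rewrite inE yT xy.
  by rewrite Tz !inE => /eqP-> /eqP->.
exists Q; split=> //.
  by rewrite cardsU1 (contra (subsetP QS B)) // cardQ add1n prednK // ltnW.
rewrite inE eE; apply/subsetP => x xe; apply/bigcupP.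
have [->|xv] := eqVneq x v; first by exists B; rewrite ?setU11.
have xev : x \in e :\ v by rewrite !inE xv.
exists (pblock P x); last by have [] := blockS x (eT x xev).
by apply: setU1r; apply/imsetP; exists x.
Qed.

(** An extension of an independent partial transversal by a vertex of B either is
again independent or is one of the conflicts counted in [card_conflict]. *)
Lemma card_extend S B : S \subset P -> B \in P -> B \notin S ->
  k * #|partial_transversals S| <= #|partial_transversals (B |: S)| +
    \sum_(Q : {set {set V}} | (Q \subset S) && (#|Q| == r.-1))
      s * #|partial_transversals (S :\: Q)|.
Proof.
move=> SP BP BS.
pose good := [set p in setX (partial_transversals S) B | p.2 |: p.1 \in partial_transversals (B |: S)].
pose bad e := [set p in setX (partial_transversals S) B | e \subset p.2 |: p.1].
pose QQ := [pred Q : {set {set V}} | (Q \subset S) && (#|Q| == r.-1)].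
have -> : k * #|partial_transversals S| = #|setX (partial_transversals S) B|.
  by rewrite cardsX (card_part BP) mulnC.
have cover_pairs : setX (partial_transversals S) B \subset
    good :|: \bigcup_(Q in QQ) \bigcup_(e in induced_edges E (B |: Q)) bad e.
  apply/subsetP => -[T v] Tv; have /setXP[/= TS vB] := Tv.
  rewrite inE [_ \in good]inE Tv /=.
  have [//|/= notgood] := boolP (v |: T \in _).
  have [e eE evT] : exists2 e, e \in E & e \subset v |: T.
    apply/exists_inP; apply: contraR notgood => /exists_inPn noedge.
    move: TS; rewrite !inE => /and3P[TS /forall_inP T1 _]; apply/and3P; split.
    - apply/subsetP => x /setU1P[->|/(subsetP TS)/bigcupP[B' B'S xB']]; apply/bigcupP.
        by exists B; rewrite ?setU11.
      by exists B'; rewrite ?setU1r.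
    - apply/forall_inP => B' /setU1P[->|B'S]; apply/eqP.
        apply/eqP/cards1P; exists v; apply/setP => x; rewrite !inE.
        have [->|xv] := eqVneq x v; first by rewrite vB.
        apply/negP => /andP[/(subsetP TS)/bigcupP[B1 B1S xB1] xB].
        by case/negP: BS; rewrite (block_eq BP (subsetP SP _ B1S) xB xB1).
      rewrite -(eqP (T1 _ B'S)); apply: eq_card => x; rewrite !inE.
      have [->|//] := eqVneq x v; case vB': (v \in B'); rewrite ?andbF //.
      by case/negP: BS; rewrite (block_eq BP (subsetP SP _ B'S) vB vB').
    - by apply/forall_inP.
  have [Q [QS cardQ _ eQ]] := conflict_edge SP BP BS TS vB eE evT.
  apply/bigcupP; exists Q; first by rewrite inE QS cardQ eqxx.
  by apply/bigcupP; exists e; rewrite // inE Tv.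
apply: leq_trans (subset_leq_card cover_pairs) _.
apply: leq_trans (leq_card_setU _ _) _; apply: leq_add.
  have TB T v : T \in partial_transversals S -> v \in B -> v \notin T.
    rewrite inE => /and3P[/subsetP TS _ _] vB; apply/negP => /TS/bigcupP[B' B'S vB'].
    by case/negP: BS; rewrite (block_eq BP (subsetP SP _ B'S) vB vB').
  rewrite -(@card_in_imset _ _ (fun p : {set V} * V => p.2 |: p.1)).
    by apply/subset_leq_card/subsetP => A /imsetP[p]; rewrite inE => /andP[_ ?] ->.
  move=> [T v] [T' v']; rewrite ![_ \in good]inE /=.
  move=> /andP[/setXP[/= TS vB] _] /andP[/setXP[/= TS' vB'] _] TT'.
  have vv' : v = v'.
    have /setU1P[//|] : v \in v' |: T' by rewrite -TT' setU11.
    by rewrite (negPf (TB _ _ TS' vB)).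
  by rewrite -vv' in TT' *; rewrite -(setU1K (TB _ _ TS vB)) TT' setU1K // (TB _ _ TS').
apply: leq_trans (leq_card_bigcup _ _) _; apply: leq_sum => Q /andP[QS /eqP cardQ].
have cardBQ : #|B |: Q| = r.
  by rewrite cardsU1 (contra (subsetP QS B)) // cardQ add1n prednK // ltnW.
apply: leq_trans (leq_card_bigcup _ _) _.
have -> : s = #|induced_edges E (B |: Q)|.
  have BQP : B |: Q \subset P by rewrite subUset sub1set BP (subset_trans QS).
  by have [_ _ _ _ /(_ _ BQP cardBQ)[->]] := H.
by rewrite -sum_nat_const; apply: leq_sum => e eQ; apply: card_conflict.
Qed.

(** By growth for smaller families, S without the r - 1 parts of Q has at most
(2 / k) ^ (r - 1) times as many partial transversals as S. With this and
sparsity, the conflicts of [card_extend] make up at most half of the extensions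
by vertices of B. *)
Lemma partial_transversals_growth S B : S \subset P -> B \in P -> B \notin S ->
  k * #|partial_transversals S| <= 2 * #|partial_transversals (B |: S)|.
Proof.
have [c] := ubnP #|S|; elim: c S B => // c IH S B /ltnSE Sc SP BP BS.
(* Removing the parts of Q one at a time, each step is growth for fewer parts. *)
have remove Q : Q \subset S ->
    k ^ #|Q| * #|partial_transversals (S :\: Q)| <= 2 ^ #|Q| * #|partial_transversals S|.
  move: {2}#|Q| (erefl #|Q|) => d; elim: d Q => [|d IHd] Q cardQ QS.
    by move/eqP: cardQ; rewrite cards_eq0 => /eqP->; rewrite cards0 setD0.
  have /card_gt0P[A AQ] : 0 < #|Q| by rewrite cardQ.
  have cardQA : #|Q :\ A| = d by move: cardQ; rewrite (cardsD1 A) AQ add1n => -[].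
  have := IHd (Q :\ A) cardQA (subset_trans (subsetDl _ _) QS).
  have -> : S :\: (Q :\ A) = A |: (S :\: Q).
    apply/setP => X; rewrite !inE; have [->|XA] := eqVneq X A; last by [].
    by rewrite (subsetP QS).
  have := IH (S :\: Q) A; rewrite cardQA cardQ !expnS => IHA IHQ.
  have {}IHA : k * #|partial_transversals (S :\: Q)| <= 2 * #|partial_transversals (A |: S :\: Q)|.
    apply: IHA; last by rewrite inE AQ.
    - apply: leq_trans Sc; rewrite proper_card // properEneq subsetDl andbT.
      by apply: contraTneq (subsetP QS A AQ) => <-; rewrite inE AQ.
    - by rewrite (subset_trans (subsetDl _ _)).
    - by rewrite (subsetP SP) ?(subsetP QS).
  apply: (@leq_trans (k ^ d * (2 * #|partial_transversals (A |: S :\: Q)|))).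
    by rewrite -mulnA mulnCA leq_mul2l IHA orbT.
  by rewrite mulnCA -mulnA leq_mul2l IHQ.
have kr_gt0 : 0 < k ^ r.-1 by rewrite expn_gt0 k_gt0.
pose X := #|partial_transversals S|; pose D := 'C(#|S|, r.-1).
have conflicts : k ^ r.-1 * (\sum_(Q : {set {set V}} | (Q \subset S) && (#|Q| == r.-1))
    s * #|partial_transversals (S :\: Q)|) <= D * (s * (2 ^ r.-1 * X)).
  rewrite /D -cards_draws -sum_nat_const big_distrr /=.
  rewrite (eq_bigl (fun Q => Q \in [set Q : {set {set V}} | Q \subset S & #|Q| == r.-1])).
    apply: leq_sum => Q; rewrite inE => /andP[QS /eqP cardQ].
    by rewrite mulnCA leq_mul2l -cardQ remove ?orbT.
  by move=> Q; rewrite inE.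
have S_lt : #|S| < n.
  by rewrite -cardP proper_card // properEneq SP andbT; apply: contraNneq BS => ->.
have Dsparse : D * s * 2 ^ r <= k ^ r.
  by apply: leq_trans sparse; rewrite !leq_mul2r leq_bin2l ?orbT // -ltnS (ltn_predK S_lt).
have := card_extend SP BP BS; rewrite -/X -(leq_pmul2l kr_gt0) mulnDr => extend.
rewrite -(leq_pmul2l kr_gt0).
have {}Dsparse : 2 * (D * (s * (2 ^ r.-1 * X))) <= k ^ r.-1 * (k * X).
  have := Dsparse; rewrite -(@prednK r) ?(ltnW r_gt1) // !expnS /= => le_k.
  have := leq_mul le_k (leqnn X).
  by rewrite -!mulnA; congr (_ <= _); lia.
rewrite -/X mulnCA; lia.
Qed.

Lemma sparse_independent_transversal : exists T, independent_transversal P E T.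
Proof.
have growing S : S \subset P -> 0 < #|partial_transversals S|.
  move: {2}#|S| (erefl #|S|) => c; elim: c S => [|c IH] S cardS SP.
    move/eqP: cardS; rewrite cards_eq0 => /eqP->; apply/card_gt0P; exists set0.
    rewrite inE; apply/and3P; split; first exact: sub0set.
      by apply/forall_inP => B; rewrite inE.
    apply/forall_inP => e eE; rewrite subset0 -cards_eq0 (edge_card eE) -lt0n.
    exact: ltnW.
  have /card_gt0P[B BS] : 0 < #|S| by rewrite cardS.
  have cardSB : #|S :\ B| = c by move: cardS; rewrite (cardsD1 B) BS add1n => -[].
  have SBP : S :\ B \subset P by rewrite (subset_trans (subsetDl _ _)).
  have := partial_transversals_growth SBP (subsetP SP B BS) (negbT (setD11 _ _)).
  rewrite setD1K // => grow.
  rewrite -(ltn_pmul2l (ltn0Sn 1)) muln0 (leq_trans _ grow) // muln_gt0 k_gt0 /=; exact: IH.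
have /card_gt0P[T] := growing P (subxx P); rewrite inE => /and3P[TP T1 /forall_inP indep].
by exists T; split=> //; rewrite /is_transversal partP T1 subsetT.
Qed.

End Counting.

(** * A graph without independent transversals from words *)

Lemma subset_between (T : finType) (A B : {set T}) n :
  A \subset B -> #|A| <= n <= #|B| -> exists C : {set T}, [/\ A \subset C, C \subset B & #|C| = n].
Proof.
move=> sAB /andP[]; elim: n => [|n IH] An nB.
  by exists A; split=> //; apply/eqP; rewrite -leqn0.
move: An; rewrite leq_eqVlt => /predU1P[An|]; first by exists A.
rewrite ltnS => An; have [C [AC CB cardC]] := IH An (ltnW nB).
have /card_gt0P[x] : 0 < #|B :\: C|.
  by rewrite cardsD (setIidPr CB) cardC subn_gt0.
rewrite inE => /andP[xC xB]; exists (x |: C); split.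
- by rewrite (subset_trans AC) // subsetUr.
- by apply/subsetP => y /setU1P[->|/(subsetP CB)].
by rewrite cardsU1 xC cardC.
Qed.

Lemma pigeonhole_fiber (T L : finType) (h : T -> L) (G : {set T}) c :
  c * #|L| < #|G| -> exists l, c < #|[set x in G | h x == l]|.
Proof.
move=> cG; apply/existsP; apply: contraLR cG => /existsPn small.
rewrite -leqNgt -sum1_card (partition_big h xpredT) //= mulnC -sum_nat_const.
by apply: leq_sum => l _; rewrite sum1dep_card leqNgt small.
Qed.

(** The vertices are the pairs (part, position), and an edge is a set of r parts
at one common position. Edges across the same r parts at different positions are
disjoint for free, so any choice [S] of s positions for each r-set of parts gives
a graph of the required kind. *)
Section GridGraph.
Variables (m k r s : nat) (S : {set 'I_m} -> {set 'I_k}).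
Hypotheses (k_gt0 : 0 < k) (r_gt0 : 0 < r).
Hypothesis cardS : forall Q, #|S Q| = s.

Definition grid_part (i : 'I_m) : {set 'I_m * 'I_k} := setX [set i] [set: 'I_k].
Definition grid_edge (Q : {set 'I_m}) (x : 'I_k) : {set 'I_m * 'I_k} := setX Q [set x].
Definition grid_parts : {set {set 'I_m * 'I_k}} := [set grid_part i | i in [set: 'I_m]].
Definition grid_edges : {set {set 'I_m * 'I_k}} :=
  [set grid_edge p.1 p.2 | p in [pred p : {set 'I_m} * 'I_k | (#|p.1| == r) && (p.2 \in S p.1)]].

Lemma in_grid_part i v : (v \in grid_part i) = (v.1 == i).
Proof. by case: v => j x; rewrite !inE /= andbT. Qed.

Lemma in_grid_edge Q x v : (v \in grid_edge Q x) = (v.1 \in Q) && (v.2 == x).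
Proof. by case: v => j y; rewrite !inE /=. Qed.

Lemma grid_part_inj : injective grid_part.
Proof.
move=> i j ij; have := in_grid_part j (i, Ordinal k_gt0).
by rewrite -ij in_grid_part eqxx => /esym/eqP.
Qed.

Lemma grid_partition : partition grid_parts [set: 'I_m * 'I_k].
Proof.
apply/and3P; split.
- apply/eqP/setP => v; rewrite inE; apply/bigcupP; exists (grid_part v.1).
    by apply/imsetP; exists v.1; rewrite ?inE.
  by rewrite in_grid_part.
- apply/trivIsetP => _ _ /imsetP[i _ ->] /imsetP[j _ ->] ij.
  rewrite -setI_eq0; apply/eqP/setP => v; rewrite !inE /= !andbT.
  by apply: contraNF ij => /andP[/eqP<- /eqP<-].
- apply/imsetP => -[i _ /setP/(_ (i, Ordinal k_gt0))].
  by rewrite in_grid_part eqxx inE.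
Qed.

Lemma grid_nkrs : nkrs_graph m k r s grid_parts grid_edges.
Proof.
split.
- by move=> _ /imsetP[p /andP[/eqP cardp _] ->]; rewrite cardsX cards1 muln1.
- exact: grid_partition.
- by rewrite card_imset ?cardsT ?card_ord //; apply: grid_part_inj.
- by move=> _ /imsetP[i _ ->]; rewrite cardsX cards1 mul1n cardsT card_ord.
move=> Q sQ cardQ; pose Q0 := [set i | grid_part i \in Q].
have QE : Q = [set grid_part i | i in Q0].
  apply/setP => B; apply/idP/imsetP => [BQ|[i]]; last by rewrite inE => iQ ->.
  by have /imsetP[i _ BE] := subsetP sQ B BQ; exists i; rewrite ?inE -?BE.
have cardQ0 : #|Q0| = r by rewrite -cardQ QE card_imset //; apply: grid_part_inj.
have coverQ v : (v \in cover Q) = (v.1 \in Q0).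
  apply/bigcupP/idP => [[B]|vQ]; last by exists (grid_part v.1); rewrite ?in_grid_part // inE in vQ *.
  by rewrite {1}QE => /imsetP[i iQ ->]; rewrite in_grid_part => /eqP->.
have indE : induced_edges grid_edges Q = [set grid_edge Q0 x | x in S Q0].
  apply/setP => e; rewrite inE; apply/andP/imsetP => [[/imsetP[[Q1 x]]]|[x xS ->]].
    rewrite inE /= => /andP[/eqP cardQ1 xS] -> /subsetP sub.
    suff -> : Q0 = Q1 by exists x.
    apply/esym/eqP; rewrite eqEcard cardQ1 cardQ0 leqnn andbT.
    by apply/subsetP => i iQ1; have := sub (i, x); rewrite in_grid_edge iQ1 eqxx coverQ; apply.
  split; first by apply/imsetP; exists (Q0, x); rewrite ?inE //= cardQ0 eqxx.
  by apply/subsetP => v; rewrite in_grid_edge coverQ => /andP[].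
have [i0 i0Q] : exists i, i \in Q0 by apply/card_gt0P; rewrite cardQ0.
rewrite indE; split.
- rewrite card_imset //; move=> x y /setP/(_ (i0, x)).
  by rewrite !in_grid_edge i0Q eqxx => /esym/eqP.
- move=> e B /imsetP[x xS ->]; rewrite QE => /imsetP[i iQ ->].
  apply/eqP/cards1P; exists (i, x); apply/setP => -[j y].
  rewrite in_setI in_grid_edge in_grid_part in_set1 xpair_eqE /=; case: (j =P i) => [->|_]; rewrite ?andbF //.
  by rewrite iQ andbT.
- apply/trivIsetP => _ _ /imsetP[x _ ->] /imsetP[y _ ->] xy.
  rewrite -setI_eq0; apply/eqP/setP => v; rewrite !inE /=.
  by apply: contraNF xy => /andP[/andP[_ /eqP<-] /andP[_ /eqP<-]].
Qed.

End GridGraph.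

(** Agreement decides the edges only across r-sets of the first
(r - 1) * k * #|C| + 1 parts; across other r-sets the edges are arbitrary. So one
family of words excludes all larger m. *)
Lemma words_no_transversal (W C : finType) k (phi : W -> 'I_k -> C) r s m :
  0 < k -> 0 < r -> s <= k ->
  (forall Q : {set W}, #|Q| = r ->
     #|[set x | [forall i in Q, forall j in Q, phi i x == phi j x]]| <= s) ->
  r.-1 * (k * #|C|) < #|W| -> r.-1 * (k * #|C|) < m ->
  ~ always_independent_transversal k r s m.
Proof.
move=> k_gt0 r_gt0 sk agree; set M := _ * _ => MW Mm always.
have /card_gt0P[w0 _] := leq_ltn_trans (leq0n M) MW.
pose psi (i : 'I_m) : W := nth w0 (enum W) i.
pose G : {set 'I_m} := [set widen_ord Mm i | i in [set: 'I_M.+1]].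
have cardG : #|G| = M.+1.
  rewrite card_imset ?cardsT ?card_ord // => i j /(congr1 val) /= ij.
  exact: val_inj.
have psi_inj : {in G &, injective psi}.
  move=> _ _ /imsetP[i _ ->] /imsetP[j _ ->] /eqP; rewrite nth_uniq ?enum_uniq //.
  - by move=> /eqP/val_inj->.
  - by rewrite -cardE (leq_trans (ltn_ord i)).
  - by rewrite -cardE (leq_trans (ltn_ord j)).
pose agr (Q : {set 'I_m}) :=
  [set x | [forall i in Q, forall j in Q, phi (psi i) x == phi (psi j) x]].
have /fin_all_exists2[S cardS agrS] : forall Q : {set 'I_m}, exists2 A : {set 'I_k},
    #|A| = s & #|Q| = r -> Q \subset G -> agr Q \subset A.
  move=> Q; have [/andP[/eqP cardQ QG]|nQ] := boolP ((#|Q| == r) && (Q \subset G)).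
    have agrQ : #|agr Q| <= s.
      have /agree : #|psi @: Q| = r.
        by rewrite card_in_imset // => i j /(subsetP QG) iG /(subsetP QG); apply: psi_inj.
      apply: leq_trans; apply/subset_leq_card/subsetP => x; rewrite !inE => /'forall_in_'forall_in_eqP H.
      apply/'forall_in_'forall_in_eqP => _ /imsetP[i iQ ->] _ /imsetP[j jQ ->].
      exact: H.
    have [|A [QA _ cardA]] := @subset_between _ (agr Q) setT s (subsetT _).
      by rewrite agrQ cardsT card_ord.
    by exists A.
  have [|A [_ _ cardA]] := @subset_between _ set0 [set: 'I_k] s (subsetT _).
    by rewrite cards0 cardsT card_ord.
  by exists A => // cardQ QG; rewrite cardQ eqxx QG in nQ.
have [T [/and3P[_ _ /forall_inP T1] indep]] := always _ _ _ (grid_nkrs k_gt0 r_gt0 cardS).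
have /fin_all_exists[x xT] : forall i : 'I_m, exists x, (i, x) \in T.
  move=> i; have /cards1P[[j x] Tx] : #|T :&: grid_part k i| == 1.
    by apply: T1; apply/imsetP; exists i.
  have := set11 (j, x); rewrite -Tx inE in_grid_part /= => /andP[jT /eqP ji].
  by exists x; rewrite -ji.
(* The label of a part is the chosen position together with its letter there. *)
have [|[y c]] := @pigeonhole_fiber _ _ (fun i => (x i, phi (psi i) (x i))) G r.-1.
  by rewrite cardG card_prod card_ord.
rewrite prednK // => fiber.
have [|Q [_ QF cardQ]] := @subset_between _ set0 _ r (sub0set [set i in G | (x i, phi (psi i) (x i)) == (y, c)]).
  by rewrite cards0.
have QP i : i \in Q -> [/\ i \in G, x i = y & phi (psi i) y = c].
  by move=> /(subsetP QF); rewrite inE => /andP[iG /eqP[<- <-]].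
have QG : Q \subset G by apply/subsetP => i /QP[].
have yS : y \in S Q.
  apply: (subsetP (agrS Q cardQ QG)); rewrite inE; apply/'forall_in_'forall_in_eqP.
  by move=> i /QP[_ _ ->] j /QP[_ _ ->].
have /indep/negP[] : grid_edge Q y \in grid_edges r S.
  by apply/imsetP; exists (Q, y); rewrite ?inE //= cardQ eqxx.
apply/subsetP => -[i z]; rewrite in_grid_edge /= => /andP[/QP[_ xi _] /eqP->].
by rewrite -xi.
Qed.

(** * Systems of product equations *)

Local Open Scope ring_scope.

Section ProductSystem.
Variables (K : fieldType) (I : finType) (T : Type).
Implicit Types (R : {set I}) (f g h : T -> K).

(** The system is stored by columns: column j holds the j-th unknown, as a
function of the solution, and the constants a_ij of all rows i. *)
Definition column := ((T -> K) * (I -> K))%type.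
Implicit Types (c : column) (cs : seq column).

(** The span of the monomials in which the successive unknowns have degrees at
most n - 1 + N, n - 2 + N, ..., N, where n is the number of columns. For N = 0
there are n! monomials, which is the bound to be proved. Spaces are predicates
on functions on the solution set, which keeps all polynomials univariate. *)
Fixpoint staircase (N : nat) cs (f : T -> K) : Prop :=
  if cs is c :: cs' then
    exists2 g : nat -> T -> K, forall e, staircase N cs' (g e) &
      forall y, f y = \sum_(e < (size cs' + N).+1) c.1 y ^+ e * g e y
  else exists a, forall y, f y = a.

Definition row_product cs i (y : T) := \prod_(c <- cs) (c.1 y - c.2 i).

Fixpoint distinct_rows cs : Prop :=
  if cs is c :: cs' then injective c.2 /\ distinct_rows cs' else True.

(** The part of the ideal generated by the left-hand sides of the rows in R that
has multipliers in the N-th staircase space; controlling the degrees of the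
multipliers is what makes the degree descent work. *)
Definition row_ideal N cs R f :=
  exists2 u : I -> T -> K, forall i, staircase N cs (u i) &
    forall y, f y = \sum_(i in R) row_product cs i y * u i y.

Lemma eq_staircase N cs f g : f =1 g -> staircase N cs f -> staircase N cs g.
Proof.
case: cs => [|c cs] E /= [h H]; first by exists h => y; rewrite -E.
by move=> Hf; exists h => // y; rewrite -E.
Qed.

Lemma staircase0 N cs : staircase N cs (fun=> 0).
Proof.
elim: cs => [|c cs IH] /=; first by exists 0.
by exists (fun _ _ => 0) => // y; rewrite big1 // => e _; rewrite mulr0.
Qed.

Lemma staircaseD N cs f g : staircase N cs f -> staircase N cs g ->
  staircase N cs (fun y => f y + g y).
Proof.
elim: cs f g => [|c cs IH] f g /=.
  by case=> a fa [b gb]; exists (a + b) => y; rewrite fa gb.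
case=> u Wu fE [v Wv gE]; exists (fun e y => u e y + v e y).
  by move=> e; apply: IH.
by move=> y; rewrite fE gE -big_split; apply: eq_bigr => e _; rewrite mulrDr.
Qed.

Lemma staircaseZ N cs a f : staircase N cs f -> staircase N cs (fun y => a * f y).
Proof.
elim: cs f => [|c cs IH] f /=; first by case=> b fb; exists (a * b) => y; rewrite fb.
case=> u Wu fE; exists (fun e y => a * u e y); first by move=> e; apply: IH.
by move=> y; rewrite fE mulr_sumr; apply: eq_bigr => e _; rewrite mulrCA.
Qed.

Lemma staircase_sum N cs (X : Type) (r : seq X) (P : pred X) (F : X -> T -> K) :
  (forall i, P i -> staircase N cs (F i)) ->
  staircase N cs (fun y => \sum_(i <- r | P i) F i y).
Proof.
move=> HF; elim: r => [|i r IH].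
  by apply: eq_staircase (staircase0 N cs) => y; rewrite big_nil.
case Pi: (P i).
  apply: eq_staircase (staircaseD (HF i Pi) IH) => y; by rewrite big_cons Pi.
by apply: eq_staircase IH => y; rewrite big_cons Pi.
Qed.

Lemma staircase_horner N c cs (p : {poly K}) f : staircase N cs f ->
  (size p <= (size cs + N).+1)%N -> staircase N (c :: cs) (fun y => p.[c.1 y] * f y).
Proof.
move=> Wf sp; exists (fun e y => p`_e * f y); first by move=> e; apply: staircaseZ.
move=> y; rewrite (horner_coef_wide _ sp) mulr_suml.
by apply: eq_bigr => e _; rewrite mulrA [_ * p`_e]mulrC.
Qed.

Lemma eq_row_ideal N cs R f g : f =1 g -> row_ideal N cs R f -> row_ideal N cs R g.
Proof. by move=> E [u Wu H]; exists u => // y; rewrite -E. Qed.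

Lemma row_ideal0 N cs R : row_ideal N cs R (fun=> 0).
Proof.
exists (fun _ _ => 0); first by move=> i; apply: staircase0.
by move=> y; rewrite big1 // => i _; rewrite mulr0.
Qed.

Lemma row_idealD N cs R f g : row_ideal N cs R f -> row_ideal N cs R g ->
  row_ideal N cs R (fun y => f y + g y).
Proof.
case=> u Wu fE [v Wv gE]; exists (fun i y => u i y + v i y).
  by move=> i; apply: staircaseD.
by move=> y; rewrite fE gE -big_split; apply: eq_bigr => e _; rewrite mulrDr.
Qed.

Lemma row_ideal_sum N cs R (X : Type) (r : seq X) (P : pred X) (F : X -> T -> K) :
  (forall i, P i -> row_ideal N cs R (F i)) ->
  row_ideal N cs R (fun y => \sum_(i <- r | P i) F i y).
Proof.
move=> HF; elim: r => [|i r IH].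
  by apply: eq_row_ideal (row_ideal0 N cs R) => y; rewrite big_nil.
case Pi: (P i).
  by apply: eq_row_ideal (row_idealD (HF i Pi) IH) => y; rewrite big_cons Pi.
by apply: eq_row_ideal IH => y; rewrite big_cons Pi.
Qed.

Lemma row_ideal_sub N cs R R' f : R \subset R' -> row_ideal N cs R f -> row_ideal N cs R' f.
Proof.
move=> sRR [u Wu fE]; exists (fun i y => if i \in R then u i y else 0).
  by move=> i; case: (i \in R); [exact: Wu | exact: staircase0].
move=> y; rewrite fE [RHS](@big_setID _ _ _ _ R' R) /= (setIidPr sRR) [X in _ + X]big1 ?addr0.
  by apply: eq_bigr => i ->.
by move=> i; rewrite inE => /andP[/negPf-> _]; rewrite mulr0.
Qed.

(** A factor p in the new unknown with a root at a_i contains the factor x - a_i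
that completes the shorter product of row i to the longer one. *)
Lemma row_ideal_horner N c cs R (p : {poly K}) f : row_ideal N cs R f ->
  (forall i, i \in R -> root p (c.2 i)) -> (size p <= (size cs + N).+2)%N ->
  row_ideal N (c :: cs) R (fun y => p.[c.1 y] * f y).
Proof.
case=> u Wu fE rp sp; pose q i := p %/ ('X - (c.2 i)%:P).
exists (fun i y => (q i).[c.1 y] * u i y).
  move=> i; apply: staircase_horner => //.
  by rewrite size_divp ?polyXsubC_eq0 // size_XsubC leq_subLR.
move=> y; rewrite fE mulr_sumr; apply: eq_bigr => i iR.
have -> : p.[c.1 y] = (c.1 y - c.2 i) * (q i).[c.1 y].
  have /rp := iR; rewrite -dvdp_XsubCl => /divpK <-.
  by rewrite hornerM hornerXsubC mulrC.
by rewrite /row_product big_cons mulrACA.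
Qed.

Definition nodal R (a : I -> K) : {poly K} := \prod_(i in R) ('X - (a i)%:P).

Lemma size_nodal R a : size (nodal R a) = #|R|.+1.
Proof. by rewrite /nodal -big_enum size_prod_XsubC -cardE. Qed.

Lemma root_nodal R a i : i \in R -> root (nodal R a) (a i).
Proof.
by move=> iR; rewrite /root /nodal (bigD1 i) //= hornerM hornerXsubC subrr mul0r.
Qed.

(** Interpolation at the constants of one column. The nodal polynomial of row l
vanishes at the constants of all rows but l, which is what
[row_ideal_horner] asks for when the remaining columns are treated by induction
with the rows other than l. *)
Lemma lagrange_remainder R (a : I -> K) (p : {poly K}) : injective a ->
  exists z : I -> K, let p' := p - \sum_(l in R) z l *: nodal (R :\ l) a in
    (forall i, i \in R -> root p' (a i)) /\ (size p' <= maxn (size p) #|R|)%N.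
Proof.
move=> inj_a; exists (fun l => p.[a l] / (nodal (R :\ l) a).[a l]) => p'.
have nodal0 l i : i \in R -> i != l -> (nodal (R :\ l) a).[a i] = 0.
  by move=> iR il; apply/rootP/root_nodal; rewrite !inE il.
split=> [i iR|].
  rewrite /root /p' hornerD hornerN horner_sum (bigD1 i) //= big1 ?addr0.
    rewrite hornerZ divfK ?subrr // /nodal horner_prod.
    apply/prodf_neq0 => j; rewrite !inE hornerXsubC subr_eq0 => /andP[ji _].
    by rewrite (inj_eq inj_a) eq_sym.
  by move=> l /andP[lR li]; rewrite hornerZ (nodal0 l i iR) ?mulr0 // eq_sym.
rewrite /p' (leq_trans (size_polyD _ _)) // geq_max leq_maxl size_polyN /=.
rewrite (leq_trans (size_sum _ _ _)) //; apply/bigmax_leqP => l lR.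
rewrite (leq_trans (size_scale_leq _ _)) // size_nodal.
by rewrite leq_max (cardsD1 l R) lR leqnn orbT.
Qed.

(** With one row more than columns the system has no common zero, since a zero of
all left-hand sides would match rows to distinct columns. Accordingly the ideal
is everything, already with multipliers of smaller degree. *)
Lemma staircase_sub_ideal N cs R f :
  distinct_rows cs -> #|R| = (size cs).+1 ->
  staircase N.+1 cs f -> row_ideal N cs R f.
Proof.
elim: cs R f => [|c cs IH] R f; first move=> _ cardR.
  case=> a fa; have /card_gt0P[i iR] : (0 < #|R|)%N by rewrite cardR.
  apply: (@row_ideal_sub _ _ [set i]); first by rewrite sub1set.
  exists (fun _ _ => a); first by move=> j; exists a.
  by move=> y; rewrite big_set1 fa /row_product big_nil mul1r.
rewrite [distinct_rows _]/= [staircase N.+1 _ _]/= => -[inj_c inj_cs] cardR [g Wg fE]; apply: eq_row_ideal (fun y => esym (fE y)) _.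
apply: row_ideal_sum => e _.
have Jg l : l \in R -> row_ideal N cs (R :\ l) (g e).
  by move=> lR; apply: IH => //; move: cardR; rewrite /= (cardsD1 l) lR add1n => -[].
have [z] := lagrange_remainder R 'X^e inj_c.
set p' := _ - _ => -[root_p' size_p'].
have {size_p'} size_p' : (size p' <= (size cs + N).+2)%N.
  apply: leq_trans size_p' _; rewrite size_polyXn geq_max cardR /= !ltnS leq_addr andbT.
  by rewrite -ltnS (leq_trans (ltn_ord e)) // addnS.
have p'E : 'X^e = p' + \sum_(l in R) z l *: nodal (R :\ l) c.2 by rewrite subrK.
have [l0 l0R] : exists l, l \in R by apply/card_gt0P; rewrite cardR.
have J1 : row_ideal N (c :: cs) R (fun y => p'.[c.1 y] * g e y).
  apply: (@row_ideal_sub _ _ (R :\ l0)); first exact: subsetDl.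
  by apply: row_ideal_horner (Jg _ l0R) _ _ => // i /setD1P[_ /root_p'].
have J2 l : l \in R ->
    row_ideal N (c :: cs) R (fun y => (z l *: nodal (R :\ l) c.2).[c.1 y] * g e y).
  move=> lR; apply: (@row_ideal_sub _ _ (R :\ l)); first exact: subsetDl.
  apply: row_ideal_horner (Jg _ lR) _ _.
    by move=> i iRl; rewrite /root hornerZ (eqP (root_nodal _ iRl)) mulr0.
  rewrite (leq_trans (size_scale_leq _ _)) // size_nodal.
  by move: cardR; rewrite /= (cardsD1 l) lR add1n => -[->]; rewrite !ltnS leq_addr.
apply: eq_row_ideal (row_idealD J1 (row_ideal_sum (index_enum I) J2)) => y /=.
rewrite -mulr_suml -horner_sum -mulrDl -hornerD.
by rewrite -[in RHS](hornerXn (c.1 y) e) p'E.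
Qed.

(** With as many rows as columns, degrees can be lowered modulo the ideal. In the
head unknown x, write x^e by [lagrange_remainder]. The nodal terms have low
degree in x and reduce to the smaller system without one row; the remainder
vanishes at all rows, and its cofactor lies in the ideal of all rows of the
remaining columns by [staircase_sub_ideal]. *)
Lemma staircase_lower N cs R f :
  distinct_rows cs -> #|R| = size cs ->
  staircase N.+1 cs f -> exists w j, [/\ staircase N cs w, row_ideal N cs R j &
    forall y, f y = w y + j y].
Proof.
elim: cs R f => [|c cs IH] R f; first move=> _ cardR.
  case=> a fa; exists f, (fun=> 0); split; [by exists a| exact: row_ideal0 |].
  by move=> y; rewrite addr0.
rewrite [distinct_rows _]/= [staircase N.+1 _ _]/= => -[inj_c inj_cs] cardR [g Wg fE].
suff /fin_all_exists2[w H] : forall e : 'I_(size cs + N.+1).+1, exists2 w : T -> K,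
   staircase N (c :: cs) w & row_ideal N (c :: cs) R (fun y => c.1 y ^+ e * g e y - w y).
  move=> J; exists (fun y => \sum_e w e y).
  exists (fun y => \sum_(e < (size cs + N.+1).+1) (c.1 y ^+ e * g e y - w e y)); split.
  - by apply: staircase_sum => e _.
  - by apply: row_ideal_sum => e _.
  - by move=> y; rewrite fE -big_split; apply: eq_bigr => e _ /=; rewrite addrC subrK.
move=> e.
have [z] := lagrange_remainder R 'X^e inj_c.
set p' := _ - _ => -[root_p' size_p'].
have {size_p'} size_p' : (size p' <= (size cs + N).+2)%N.
  apply: leq_trans size_p' _; rewrite size_polyXn geq_max cardR /= !ltnS.
  by rewrite -ltnS (leq_trans (ltn_ord e)) ?addnS // leqW ?leq_addr.
have p'E : 'X^e = p' + \sum_(l in R) z l *: nodal (R :\ l) c.2 by rewrite subrK.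
have J1 : row_ideal N (c :: cs) R (fun y => p'.[c.1 y] * g e y).
  by apply: row_ideal_horner => //; apply: staircase_sub_ideal.
have /fin_all_exists2[w Ww Jw] : forall l, exists2 w : T -> K, staircase N (c :: cs) w &
   l \in R -> row_ideal N (c :: cs) R
     (fun y => (z l *: nodal (R :\ l) c.2).[c.1 y] * g e y - w y).
  move=> l; case lR: (l \in R); last by exists (fun=> 0) => //; apply: staircase0.
  have cardRl : #|R :\ l| = size cs by move: cardR; rewrite /= (cardsD1 l) lR add1n => -[].
  have size_l : (size (z l *: nodal (R :\ l) c.2) <= (size cs).+1)%N.
    by rewrite (leq_trans (size_scale_leq _ _)) // size_nodal cardRl.
  have [w [j [Ww Jj gE]]] := IH (R :\ l) (g e) inj_cs cardRl (Wg e).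
  exists (fun y => (z l *: nodal (R :\ l) c.2).[c.1 y] * w y).
    by apply: staircase_horner => //; rewrite (leq_trans size_l) // ltnS leq_addr.
  move=> _; apply: (@row_ideal_sub _ _ (R :\ l)); first exact: subsetDl.
  apply: (@eq_row_ideal _ _ _ (fun y => (z l *: nodal (R :\ l) c.2).[c.1 y] * j y)).
    by move=> y; rewrite gE mulrDr addrC addKr.
  apply: row_ideal_horner => // [i iRl|].
    by rewrite /root hornerZ (eqP (root_nodal _ iRl)) mulr0.
  by rewrite (leq_trans size_l) // ltnS leqW // leq_addr.
exists (fun y => \sum_(l in R) w l y); first by apply: staircase_sum => l _.
apply: eq_row_ideal (row_idealD J1 (row_ideal_sum (index_enum I) Jw)) => y /=.
rewrite sumrB -mulr_suml -horner_sum addrA -mulrDl -hornerD.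
by rewrite -[in RHS](hornerXn (c.1 y) e) p'E.
Qed.

(** On a solution set the left-hand sides are constants, so the multipliers of an
ideal element may be used in place of the element, and they have smaller
degree. *)
Lemma staircase_collapse N cs R f :
  distinct_rows cs -> #|R| = size cs ->
  (forall i, i \in R -> exists b, forall y, row_product cs i y = b) ->
  staircase N cs f -> staircase 0 cs f.
Proof.
move=> inj_cs cardR row_const; elim: N => // N IH /staircase_lower.
case/(_ R inj_cs cardR) => w [j [Ww [u Wu jE] fE]]; apply: IH.
apply: (@eq_staircase _ _ (fun y => w y + \sum_(i in R) row_product cs i y * u i y)).
  by move=> y; rewrite fE jE.
apply: staircaseD => //; apply: staircase_sum => i /row_const[b bE].
by apply: eq_staircase (staircaseZ b (Wu i)) => y; rewrite bE.
Qed.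

Lemma staircase0_dim cs : exists2 X : finType, #|X| = (size cs)`! &
  exists B : X -> T -> K,
    forall f, staircase 0 cs f -> exists a, forall y, f y = \sum_x a x * B x y.
Proof.
elim: cs => [|c cs [X cardX [B HB]]].
  exists unit; first by rewrite card_unit.
  exists (fun _ _ => 1) => f [a fa]; exists (fun=> a) => y.
  by rewrite (big_pred1 tt) ?mulr1 // => -[].
exists ('I_(size cs).+1 * X)%type; first by rewrite card_prod card_ord factS cardX.
exists (fun (x : 'I_(size cs).+1 * X) y => c.1 y ^+ x.1 * B x.2 y) => f.
rewrite [staircase 0 _ _]/= addn0 => -[g Wg fE].
have /boolp.choice[a aE] : forall e, exists a, forall y, g e y = \sum_x a x * B x y.
  by move=> e; apply: HB.
exists (fun x : 'I_(size cs).+1 * X => a x.1 x.2) => y.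
rewrite fE -(pair_bigA _ (fun (e : 'I_(size cs).+1) x => a e x * (c.1 y ^+ e * B x y))) /=.
apply: eq_bigr => e _; rewrite aE mulr_sumr.
by apply: eq_bigr => x _; rewrite mulrCA.
Qed.

Lemma staircase_head N c cs (p : {poly K}) : (size p <= N)%N ->
  staircase N (c :: cs) (fun y => p.[c.1 y]).
Proof.
move=> sp; apply: (@eq_staircase _ _ (fun y => p.[c.1 y] * 1)).
  by move=> y; rewrite mulr1.
apply: staircase_horner; last by rewrite leqW // (leq_trans sp) // leq_addl.
elim: cs => [|d cs IH]; first by exists 1.
apply: (@eq_staircase _ _ (fun y => 1.[d.1 y] * 1)); first by move=> y; rewrite hornerC mulr1.
by apply: staircase_horner => //; rewrite size_poly1.
Qed.


End ProductSystem.

(** If the head unknown separates the solutions, every function on the solution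
set is a polynomial in it, hence lies in the staircase space of dimension at
most n!. So the number of solutions, which is the dimension of the space of all
functions, is at most n!. *)
Lemma card_product_system_le (K : fieldType) (I T : finType) c cs (R : {set I}) :
  injective c.1 -> @distinct_rows K I T (c :: cs) -> #|R| = (size cs).+1 ->
  (forall i, i \in R -> exists b, forall y, row_product (c :: cs) i y = b) ->
  (#|T| <= (size cs).+1`!)%N.
Proof.
move=> inj_c dist cardR row_const.
have [X cardX [B HB]] := staircase0_dim (c :: cs).
have /boolp.choice[a aE] : forall y0 : T, exists a : X -> K,
    forall y, (y0 == y)%:R = \sum_x a x * B x y.
  move=> y0; apply: HB.
  apply: (@staircase_collapse _ _ _ (size (nodal (~: [set y0]) c.1)) _ R) => //.
  pose p := (nodal (~: [set y0]) c.1).[c.1 y0].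
  have p0 : p != 0.
    rewrite /p /nodal horner_prod; apply/prodf_neq0 => y; rewrite !inE hornerXsubC subr_eq0.
    by rewrite (inj_eq inj_c) eq_sym.
  apply: eq_staircase (staircaseZ p^-1 (staircase_head _ _ (leqnn _))) => y.
  have [<-|y0y] := eqVneq; first by rewrite mulVf.
  by rewrite (rootP (root_nodal _ _)) ?mulr0 // !inE eq_sym.
rewrite -[X in (_ <= X)%N]cardX.
(* The indicator functions factor through the spanning family: M *m N = 1. *)
pose M : 'M[K]_(#|T|, #|X|) := \matrix_(i, j) a (enum_val i) (enum_val j).
pose N : 'M[K]_(#|X|, #|T|) := \matrix_(i, j) B (enum_val i) (enum_val j).
have MN : M *m N = 1%:M.
  apply/matrixP => i j; rewrite !mxE -(inj_eq enum_val_inj) aE [RHS](eq_bigl (mem X)) // [RHS]big_enum_val /=.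
  by apply: eq_bigr => x _; rewrite !mxE.
by rewrite -(mxrank1 K #|T|) -MN (leq_trans (mxrankM_maxl _ _)) // rank_leq_col.
Qed.

(** * Words from norms in finite fields *)

(** Exponents x, y of one interval of length a differ by less than a, and shifts
by different multiples of a keep them apart modulo m. *)
Lemma close_residues_neq m a u v w x y :
  (a * w <= m)%N -> (u < v < w)%N -> (x < y + a)%N -> (y < x + a)%N ->
  (y + a * v == x + a * u %[mod m]) = false.
Proof.
move=> awm /andP[uv vw] xy yx.
have auv : (a * u + a <= a * v)%N by rewrite addnC -mulnS leq_mul2l uv orbT.
have avw : (a * v + a <= a * w)%N by rewrite addnC -mulnS leq_mul2l vw orbT.
rewrite eqn_mod_dvd; last by lia.
by apply/negP => /dvdn_leq le_m; have := le_m ltac:(lia); lia.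
Qed.

Section NormWords.
Variables (K : finFieldType) (q t : nat).
Hypothesis q_char : [pchar K].-nat q.

(** The norm to the subfield with q elements, as an explicit power: this makes
nonzero norms powers of one element of order q - 1. *)
Definition field_norm (x : K) := x ^+ (\sum_(j < t) q ^ j).

Lemma field_norm_prod x : field_norm x = \prod_(j < t) x ^+ (q ^ j).
Proof. by rewrite /field_norm -prodrXr. Qed.

Lemma field_normM x y : field_norm (x * y) = field_norm x * field_norm y.
Proof. exact: exprMn. Qed.

Lemma field_norm1 : field_norm 1 = 1.
Proof. exact: expr1n. Qed.

Lemma exprB_char n (x y : K) : (x - y) ^+ (q ^ n) = x ^+ (q ^ n) - y ^+ (q ^ n).
Proof.
have qn : [pchar K].-nat (q ^ n)%N by rewrite pnatX q_char.
by rewrite exprDn_pchar // exprNn_pchar.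
Qed.

Lemma exprX_char_inj n : injective (fun x : K => x ^+ (q ^ n)).
Proof.
move=> x y /eqP; rewrite -subr_eq0 -exprB_char expf_eq0 => /andP[_].
by rewrite subr_eq0 => /eqP.
Qed.

(** The substitution Y = 1 / (A0 + B) turns a quotient of two norms that both
involve B into a single norm of Y plus a constant. *)
Lemma field_norm_shift (A0 A B b : K) : A0 + B != 0 -> A != A0 ->
  field_norm (A + B) = b * field_norm (A0 + B) ->
  field_norm ((A0 + B)^-1 - (A0 - A)^-1) = b * field_norm (A - A0)^-1.
Proof.
rewrite -(subr_eq0 A) => B0 dA normB.
have -> : (A0 + B)^-1 - (A0 - A)^-1 = (A + B) * (A0 + B)^-1 * (A - A0)^-1.
  by rewrite -[A0 - A]opprB invrN opprK; field; rewrite dA B0.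
rewrite !field_normM normB -[b * _ * _]mulrA -field_normM.
by rewrite mulfV // field_norm1 mulr1.
Qed.

(** The norm of Y - c is the product of x_j - c ^ (q ^ j) over the conjugates
x_j = Y ^ (q ^ j), so the prescribed quotients form a product system; its rows
are distinct in every column because Frobenius is injective. *)
Lemma card_norm_ratio_le (I : finType) (A0 : K) (A b : I -> K) :
  injective A -> (forall i, A i != A0) -> #|I| = t -> (0 < t)%N ->
  (#|[set B : K | (A0 + B != 0)%R && [forall i,
      field_norm (A i + B) == b i * field_norm (A0 + B)]%R]| <= t`!)%N.
Proof.
move=> injA AA0 cardI t_gt0; set S := [set B | _].
pose y (B : {B | B \in S}) := (A0 + val B)^-1.
pose col j : column K I {B | B \in S} :=
  (fun B => y B ^+ (q ^ j), fun i => (A0 - A i)^-1 ^+ (q ^ j)).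
have -> : #|S| = #|{: {B | B \in S}}| by rewrite card_sig; apply: eq_card => B; rewrite inE.
have inj_y : injective y by move=> B B' /invr_inj/addrI/val_inj.
have dist_col s : distinct_rows (map col s).
  elim: s => //= j s IH; split=> // i i' /exprX_char_inj/invr_inj/addrI/oppr_inj.
  exact: injA.
have [s ts] : exists s, iota 0 t = 0%N :: s by case: (t) t_gt0 => // u _; exists (iota 1 u).
have size_s : (size s).+1 = t by rewrite -[RHS](size_iota 0) ts.
rewrite -size_s -(size_map col).
apply: (@card_product_system_le _ _ _ (col 0%N) _ [set: I]).
- by move=> B B' /exprX_char_inj/inj_y.
- exact: (dist_col (0%N :: s)).
- by rewrite size_map size_s cardsT.
move=> i _; exists (b i * field_norm (A i - A0)^-1) => B.
rewrite (_ : row_product _ i B = field_norm (y B - (A0 - A i)^-1)); last first.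
  rewrite field_norm_prod -(big_mkord xpredT (fun j => _ ^+ (q ^ j))) /index_iota subn0 ts.
  rewrite /row_product -/(map col (0%N :: s)) big_map; apply: eq_bigr => j _ /=.
  by rewrite exprB_char.
have := valP B; rewrite inE => /andP[B0 /forallP/(_ i)/eqP normB].
by apply: field_norm_shift normB; rewrite ?AA0.
Qed.

Hypotheses (cardK : #|K| = (q ^ t)%N) (q_gt1 : (1 < q)%N) (t_gt0 : (0 < t)%N).

Lemma norm_generator : exists2 g : K, q.-1.-primitive_root g &
  forall x, x != 0 -> exists e : nat, field_norm x = g ^+ e.
Proof.
have n_gt0 : (0 < (q ^ t).-1)%N by rewrite -subn1 subn_gt0 -(exp1n t) ltn_exp2r.
have unity (x : K) : x != 0 -> x ^+ (q ^ t).-1 = 1.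
  move=> x0; apply: (mulfI x0); rewrite mulr1 -exprS prednK ?expn_gt0 ?(ltnW q_gt1) //.
  by rewrite -cardK expf_card.
have /hasP[z _ prim_z] : has (q ^ t).-1.-primitive_root (enum (predC1 (0 : K))).
  apply: cyclic.has_prim_root => //.
  - by apply/allP => x; rewrite mem_enum unity_rootE => /unity->.
  - exact: enum_uniq.
  - by rewrite -cardE cardC1 cardK.
have dvd_q : (q.-1 %| (q ^ t).-1)%N by exact: dvdn_pred_predX.
exists (field_norm z).
  rewrite /field_norm -(mulKn (\sum_(j < t) q ^ j) (d := q.-1)).
    by rewrite -predn_exp; apply: dvdn_prim_root.
  by rewrite -subn1 subn_gt0.
move=> x /unity/(prim_rootP prim_z)[i ->]; exists i.
by rewrite /field_norm -!exprM mulnC.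
Qed.

(** A word is a pair (A, u), standing for division of the norm by the power a * u
of the generator g; its letter at a position is the interval that contains the
exponent of the quotient. Multiples of a, with a * u below q - 1, make words with
the same A disagree everywhere ([close_residues_neq]). Elements A with A + B = 0
for some position B are excluded, so that every letter is defined. *)
Lemma norm_words a k : (0 < a)%N -> (k <= q ^ t)%N ->
  let w := (q.-1 %/ a)%N in
  exists (W : finType) (phi : W -> 'I_k -> 'I_w.+1), #|W| = ((q ^ t - k) * w)%N /\
    forall Q : {set W}, #|Q| = t.+1 ->
      (#|[set x | [forall i in Q, forall j in Q, phi i x == phi j x]]|
        <= t`! * (2 * a - 1) ^ t)%N.
Proof.
move=> a_gt0 k_le w.
have [g prim_g norm_g] := norm_generator.
have q1_gt0 : (0 < q.-1)%N by rewrite -subn1 subn_gt0.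
pose pt (x : 'I_k) : K := enum_val (cast_ord (esym cardK) (widen_ord k_le x)).
have inj_pt : injective pt by move=> x y /enum_val_inj/cast_ord_inj/(congr1 val)/= /val_inj.
pose D := ~: [set - pt x | x in [set: 'I_k]].
have cardD : #|D| = (q ^ t - k)%N.
  have := cardsC D; rewrite setCK card_imset; last by move=> x y /oppr_inj/inj_pt.
  by rewrite cardsT card_ord cardK => <-; rewrite addnK.
have nz (A : {A | A \in D}) x : val A + pt x != 0.
  apply: contraTneq (valP A) => /eqP; rewrite addr_eq0 => /eqP AE.
  by rewrite inE negbK; apply/imsetP; exists x; rewrite ?inE //.
have /fin_all_exists[e eE] : forall i : {A | A \in D} * 'I_w * 'I_k,
    exists e : 'I_q.-1, field_norm (val i.1.1 + pt i.2) = g ^+ (e + a * i.1.2).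
  case=> [[A u] x] /=.
  have [n ->] := norm_g _ (nz A x).
  (* Adding a * u * (q - 2) subtracts a * u modulo q - 1. *)
  pose m := (n + a * u * q.-2)%N.
  exists (Ordinal (ltn_pmod m q1_gt0)) => /=.
  apply/eqP; rewrite (eq_prim_root_expr prim_g) modnDml /m -addnA -mulnSr prednK //.
  by rewrite addnC modnMDl.
pose E (i : {A | A \in D} * 'I_w) x : nat := e (i, x).
pose phi i x : 'I_w.+1 := inord (E i x %/ a).
have phiE i j x : phi i x == phi j x -> (E i x < E j x + a)%N.
  have ltE i' : (E i' x %/ a < w.+1)%N.
    by rewrite ltnS leq_div2r // ltnW // /E; case: (e _).
  move/eqP/(congr1 val); rewrite /= !inordK //.
  have := divn_eq (E i x) a; have := divn_eq (E j x) a.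
  by have := ltn_pmod (E i x) a_gt0; lia.
exists ({A | A \in D} * 'I_w)%type, phi; split.
  by rewrite card_prod card_ord card_sig -cardD; congr (_ * _)%N; apply: eq_card.
move=> Q cardQ; set S := [set x | _].
have S_close i j x : x \in S -> i \in Q -> j \in Q -> (E i x < E j x + a)%N.
  rewrite inE => /'forall_implyP/(_ i)/[swap] iQ /(_ iQ)/'forall_implyP/(_ j).
  by move=> /[swap] jQ /(_ jQ); apply: phiE.
(* From here on only this closeness of exponents is used. *)
clearbody S.
have no_repeat i j x : x \in S -> i \in Q -> j \in Q -> i.1 = j.1 -> (i.2 < j.2)%N -> False.
  move=> xS iQ jQ ij1 ij2.
  have := eE (j, x); rewrite /= -ij1 (eE (i, x)) /= => /eqP.
  rewrite (eq_prim_root_expr prim_g) eq_sym.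
  by rewrite (@close_residues_neq _ a _ _ w) ?S_close ?ij2 ?ltn_ord // mulnC leq_trunc_div.
have [->|/set0Pn[x0 x0S]] := eqVneq S set0; first by rewrite cards0.
have injQ i j : i \in Q -> j \in Q -> i.1 = j.1 -> i = j.
  move=> iQ jQ ij1; case: (ltngtP i.2 j.2) => [lt|lt|/val_inj eq2].
  - by case: (no_repeat i j x0).
  - by case: (no_repeat j i x0).
  - by rewrite (surjective_pairing i) ij1 eq2 -surjective_pairing.
have [i0 i0Q] : exists i, i \in Q by apply/card_gt0P; rewrite cardQ.
pose I : finType := {i | i \in Q :\ i0}.
have cardI : #|I| = t.
  rewrite card_sig -[RHS]/(t.+1.-1) -cardQ (cardsD1 i0) i0Q add1n /=.
  by apply: eq_card => i; rewrite inE.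
(* The vector of exponent differences to the word i0, shifted by a - 1 to be
nonnegative; each class of positions with the same differences is bounded by
card_norm_ratio_le. *)
pose d x : {ffun I -> 'I_(a.-1 * 2).+1} := [ffun i => inord (E (val i) x + a.-1 - E i0 x)].
have -> : (2 * a - 1 = (a.-1 * 2).+1)%N by lia.
have -> : (t`! * (a.-1 * 2).+1 ^ t = \sum_(d0 : {ffun I -> 'I_(a.-1 * 2).+1}) t`!)%N.
  by rewrite sum_nat_const card_ffun card_ord cardI mulnC.
rewrite -sum1_card (partition_big d xpredT) //=.
apply: leq_sum => d0 _; rewrite sum1dep_card.
pose b (i : I) := g ^+ (d0 i + a * (val i).2) / g ^+ (a.-1 + a * i0.2).
have g0 : g != 0.
  apply/eqP => g0; have /eqP := prim_expr_order prim_g.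
  by rewrite g0 expr0n gtn_eqF // eq_sym oner_eq0.
have injA : injective (fun i : I => val (val i).1).
  move=> i j /val_inj ij; apply: val_inj; apply: injQ ij.
    by have := valP i; rewrite inE => /andP[].
  by have := valP j; rewrite inE => /andP[].
have AA0 (i : I) : val (val i).1 != val i0.1.
  have := valP i; rewrite !inE => /andP[ii0 iQ]; apply: contra ii0.
  by move=> /eqP/val_inj/(injQ _ _ iQ i0Q)->.
apply: leq_trans (card_norm_ratio_le b injA AA0 cardI t_gt0).
rewrite -(card_imset _ inj_pt); apply/subset_leq_card/subsetP => y /imsetP[x].
rewrite !inE => /andP[xS /eqP dx] ->; rewrite nz /=; apply/forallP => i; apply/eqP.
have := eE (val i, x); have := eE (i0, x); rewrite /= => -> ->.
rewrite /b mulrAC -exprD; apply: (canRL (mulfK _)); first by rewrite expf_neq0.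
have iQ : val i \in Q by have := valP i; rewrite inE => /andP[].
have [lt1 lt2] := (S_close _ _ _ xS iQ i0Q, S_close _ _ _ xS i0Q iQ).
rewrite -exprD -dx ffunE -/(E _ _) -/(E _ _).
move: (E _ _) (E _ _) lt1 lt2 => u v lt1 lt2.
rewrite inordK; last by lia.
by congr (g ^+ _); move: (a * (val i).2)%N (a * i0.2)%N => m m'; lia.
Qed.

End NormWords.

Local Open Scope nat_scope.

(** * The order of magnitude *)

(** The parameters: q is the least power of two with q ^ t > (2t + 1) * k, which
leaves enough words after removal of the k excluded values of A, and a is the
largest number for which the agreement bound t! * (2a - 1) ^ t is at most s. The
hypothesis t! <= s is what makes a = 1 possible. *)
Lemma always_transversal_upper t k s m : 0 < t -> 0 < k -> t`! <= s <= k ->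
  always_independent_transversal k t.+1 s m ->
  m ^ t * s <= (t`! * (12 * t) ^ t * (2 * t + 1)) * k ^ t.+1.
Proof.
move=> t_gt0 k_gt0 /andP[ts sk] always.
have ex_e : exists e, (2 * t + 1) * k < (2 ^ e) ^ t.
  exists ((2 * t + 1) * k); apply: leq_trans (ltn_expl _ (isT : 1 < 2)) _.
  by rewrite -expnM leq_exp2l // leq_pmulr.
have [e k_lt e_min] := ex_minnP ex_e.
have e_gt0 : 0 < e by case: e k_lt {e_min} => //; rewrite exp1n; lia.
have {e_min} q_le : (2 ^ e) ^ t <= 2 ^ t * ((2 * t + 1) * k).
  rewrite -[in 2 ^ e](prednK e_gt0) expnS expnMn leq_mul2l; apply/orP; right.
  by rewrite leqNgt; apply/negP => /e_min; rewrite -ltnS prednK // ltnn.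
set q := 2 ^ e in k_lt q_le.
have q_gt1 : 1 < q by rewrite -(expn0 2) ltn_exp2l.
have ex_a : exists a, t`! * (2 * a - 1) ^ t <= s by exists 1; rewrite exp1n muln1.
have bound_a a : t`! * (2 * a - 1) ^ t <= s -> a <= s.
  move=> le_s; rewrite leqNgt; apply/negP => lt_a; have := fact_gt0 t.
  have : (2 * a - 1) ^ 1 <= (2 * a - 1) ^ t by rewrite leq_pexp2l //; lia.
  by rewrite expn1; nia.
have [a a_le a_max] := ex_maxnP ex_a bound_a.
have a_gt0 : 0 < a by apply: a_max; rewrite exp1n muln1.
have s_lt : s < t`! * (3 * a) ^ t.
  have : s < t`! * (2 * a.+1 - 1) ^ t.
    by rewrite ltnNge; apply/negP => /a_max; rewrite ltnn.
  move=> /leq_trans; apply; rewrite leq_mul2l leq_exp2r //; lia.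
have a_lt : 2 * a - 1 < q.
  rewrite -(ltn_exp2r _ _ t_gt0); apply: leq_ltn_trans k_lt.
  apply: leq_trans (_ : s <= _); last by nia.
  by apply: leq_trans a_le; rewrite leq_pmull ?fact_gt0.
have kq : k <= q ^ t by nia.
have et_gt0 : 0 < e * t by rewrite muln_gt0 e_gt0.
have [K K2 cardK] := pPrimePowerField (isT : prime 2) et_gt0.
rewrite expnM -/q in cardK.
have q_char : [pchar K]%R.-nat q by rewrite pnatX pnatE // K2.
have [W [phi []]] := norm_words q_char cardK q_gt1 t_gt0 a_gt0 kq.
set w := q.-1 %/ a => cardW agree.
have w_gt0 : 0 < w by rewrite divn_gt0 //; lia.
have m_le : m <= t * (k * w.+1).
  rewrite leqNgt; apply/negP => m_gt.
  apply: (@words_no_transversal _ _ _ phi t.+1 s m) always => //.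
  - by move=> Q /agree/leq_trans; apply.
  - by rewrite card_ord cardW /=; nia.
  - by rewrite card_ord.
have aw : w * a < q by have := leq_trunc_div q.-1 a; rewrite -/w; lia.
have ma : m * a <= 2 * t * k * q by nia.
have := leq_mul (leqnn (m ^ t)) (ltnW s_lt); move/leq_trans; apply.
have ma_t : (m * a) ^ t <= (2 * t * k) ^ t * (2 ^ t * ((2 * t + 1) * k)).
  by apply: leq_trans (_ : (2 * t * k * q) ^ t <= _); rewrite ?leq_exp2r // expnMn leq_mul2l q_le orbT.
have -> : m ^ t * (t`! * (3 * a) ^ t) = t`! * 3 ^ t * (m * a) ^ t by rewrite !expnMn; lia.
apply: leq_trans (leq_mul (leqnn _) ma_t) _.
rewrite (_ : 12 = 3 * 2 * 2) // !expnMn expnS; lia.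
Qed.

Lemma bin_le_exp n m : 'C(n, m) <= n ^ m.
Proof.
elim: m n => [|m IH] n; first by rewrite bin0 expn0.
apply: leq_trans (_ : m.+1 * 'C(n, m.+1) <= _); first by rewrite leq_pmull.
rewrite -mul_bin_diag expnS leq_mul // (leq_trans (IH _)) //.
by case: m {IH} => // m; rewrite leq_exp2r // leq_pred.
Qed.

(** The maximum F exists because the orders that force a transversal are bounded;
the lower bound on F holds since the counting argument must fail for F + 1. *)
Lemma f_bounds t k s : 0 < t -> 0 < k -> t`! <= s <= k ->
  k ^ t.+1 <= 2 ^ t.+1 * (f k t.+1 s ^ t * s) /\
  f k t.+1 s ^ t * s <= (t`! * (12 * t) ^ t * (2 * t + 1)) * k ^ t.+1.
Proof.
move=> t_gt0 k_gt0 s_range; set C := t`! * _ * _; set F := f k t.+1 s.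
have s_gt0 : 0 < s by case/andP: s_range => /(leq_trans (fact_gt0 t)).
have sparse_always n : 'C(n.-1, t) * s * 2 ^ t.+1 <= k ^ t.+1 ->
    always_independent_transversal k t.+1 s n.
  by move=> sparse V P E H; apply: (sparse_independent_transversal H).
have bounded m : `[< always_independent_transversal k t.+1 s m >] -> m <= C * k ^ t.+1.
  move=> /asboolP/(always_transversal_upper t_gt0 k_gt0 s_range) upper.
  apply: leq_trans upper.
  rewrite -[X in X <= _]muln1 leq_mul //; case: (m) => // m'.
  by rewrite -[X in X <= _]expn1 leq_pexp2l.
have nonempty : exists m, `[< always_independent_transversal k t.+1 s m >].
  by exists 1; apply/asboolP/sparse_always; rewrite bin0n gtn_eqF.
have [alwaysF maxF] : is_max_order k t.+1 s F.
  case: (ex_maxnP nonempty bounded) => n /asboolP always_n max_n.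
  have is_max : is_max_order k t.+1 s n by split=> // m /asboolP/max_n.
  by rewrite /F (f_unique is_max).
split; last exact: always_transversal_upper.
have := contra_not (sparse_always F.+1).
have notF1 : ~ always_independent_transversal k t.+1 s F.+1 by move/maxF; rewrite ltnn.
move=> /(_ notF1)/negP; rewrite -ltnNge => /ltnW/leq_trans; apply.
by rewrite mulnC leq_mul2l leq_mul2r bin_le_exp !orbT.
Qed.

Local Open Scope ring_scope.

Theorem theorem1p9 (R : realType) (r : nat) (hr : (2 <= r)%N) :
  exists c C : R, 0 < c /\ 0 < C /\
    forall k s : nat, (0 < k)%N -> (0 < s)%N -> ((r - 1)`! <= s <= k)%N ->
      c * (k%:R ^+ r / s%:R) `^ (1 / (r%:R - 1)) <= (f k r s)%:R /\
      (f k r s)%:R <= C * (k%:R ^+ r / s%:R) `^ (1 / (r%:R - 1)).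
Proof.
case: r hr => // t; rewrite ltnS => t_gt0; rewrite subn1 /=.
have -> : t.+1%:R - 1 = t%:R :> R by rewrite -natr1 addrK.
pose D := (t`! * (12 * t) ^ t * (2 * t + 1))%N.
have D_gt0 : (0 < D)%N by rewrite !muln_gt0 fact_gt0 expn_gt0 muln_gt0 t_gt0 addn_gt0 orbT.
exists ((2 ^+ t.+1)^-1 `^ (1 / t%:R)), (D%:R `^ (1 / t%:R)).
split; first by rewrite powR_gt0 // invr_gt0 exprn_gt0.
split; first by rewrite powR_gt0 // ltr0n.
move=> k s k_gt0 s_gt0 s_range.
have [lower upper] := f_bounds t_gt0 k_gt0 s_range.
set F := f _ _ _ in lower upper *; set x := _ / _.
have s0 : 0 < s%:R :> R by rewrite ltr0n.
have p0 : 0 <= 1 / t%:R :> R by rewrite divr_ge0 ?ler0n.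
have x0 : 0 <= x by rewrite divr_ge0 ?exprn_ge0 ?ler0n.
have rootF : (F%:R ^+ t) `^ (1 / t%:R) = F%:R :> R.
  by rewrite -powR_mulrn ?ler0n // -powRrM mulrC mul1r mulVf ?powRr1 ?ler0n // pnatr_eq0 -lt0n.
rewrite -!powRM ?invr_ge0 ?exprn_ge0 ?ler0n //.
split; rewrite -{}rootF ge0_ler_powR ?nnegrE ?mulr_ge0 ?invr_ge0 ?exprn_ge0 ?ler0n //.
  rewrite mulrC ler_pdivrMr ?exprn_gt0 // ler_pdivrMr //.
  rewrite -mulrA mulrCA; move: lower.
  by rewrite -(ler_nat R) !natrM !natrX.
rewrite mulrA ler_pdivlMr //.
by move: upper; rewrite -(ler_nat R) natrM natrX natrM natrX.
Qed.
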